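(* Let $l, g, \mu > 0$ be real constants and let $\xi \colon \mathbb{R} \to \mathbb{R}$ be a twice differentiable function whose second derivative $\ddot\xi$ is Lipschitz. Consider the system $$ \dot q = p, \qquad \dot p = \frac{\ddot\xi(t)}{l}\sin q - \frac{\mu}{l}\left|\ddot\xi(t)\cos q - l p^2 + g \sin q\right|\frac{p}{|p|} - \frac{g}{l}\cos q, $$ with solutions understood in the sense of the associated differential inclusion $(\dot q,\dot p)\in\Phi(q,p,t)$. Then the solutions are right-unique: for every $(q_0,p_0,t_0)\in\mathbb{R}^3$ there exists $t_1>t_0$ such that any two solutions satisfying $q(t_0)=q_0$, $p(t_0)=p_0$ coincide on $[t_0,t_1]$ (at all points of $[t_0,t_1]$ where both are defined).
   Context: The right-hand side $f(q,p,t)$ of the system is undefined (discontinuous) on the plane $M=\{p=0\}$. The associated set-valued map $\Phi$ is defined as follows: $\Phi(q,p,t)\subset\mathbb{R}^2$ is the smallest closed convex set containing all limit values of $f(q^*,p^*,t)$ as $(q^*,p^* )\to(q,p)$ with $p^*\neq 0$. Explicitly, $\Phi(q,p,t)=\{f(q,p,t)\}$ for $p\ne 0$, and $$ \Phi(q,0,t)=\{0\}\times\left[a-b,\;a+b\right],\quad a=\frac{\ddot\xi(t)}{l}\sin q-\frac{g}{l}\cos q,\quad b=\frac{\mu}{l}\left|\ddot\xi(t)\cos q+g\sin q\right|. $$ A solution is an absolutely continuous function $t\mapsto(q(t),p(t))$ on an interval or segment $I$ such that $(\dot q(t),\dot p(t))\in\Phi(q(t),p(t),t)$ for almost every $t\in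 I$. *)

(* Defs.v *)
From HB Require Import structures.
From mathcomp Require Export all_boot all_order all_algebra.
From mathcomp Require Export all_classical all_reals all_analysis.

Set Implicit Arguments.
Unset Strict Implicit.
Unset Printing Implicit Defensive.

Export Order.TTheory GRing.Theory Num.Theory.
Export numFieldNormedType.Exports.

Local Open Scope ring_scope.
Local Open Scope classical_set_scope.

Section Filippov.
Context {R : realType} {U V : normedModType R}.

(* [f] is only meaningful off the exceptional set [M]: the values it takes on
   [M] (junk, as [f] is total) do not enter the limit values. *)
Definition limit_values (f : U -> V) (M : set U) (z : U) : set V :=
  cluster (f @ within (~` M) (nbhs z)).

Definition filippov (f : U -> V) (M : set U) (z : U) : set V :=
  smallest [set C | closed C /\ convex_set C] (limit_values f M z).

End Filippov.

(* The open intervals are pairwise disjoint, so that adjacent closed intervals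
   are allowed to share an endpoint. *)
Definition absolutely_continuous {R : realType} (a b : R) (f : R -> R) : Prop :=
  forall e : R, 0 < e -> exists2 d : R, 0 < d &
    forall (n : nat) (u v : 'I_n -> R),
      (forall i, a <= u i /\ u i <= v i /\ v i <= b) ->
      trivIset setT (fun i => `]u i, v i[) ->
      \sum_(i < n) (v i - u i) < d ->
      \sum_(i < n) `|f (v i) - f (u i)| < e.

Section Pendulum.
Context {R : realType}.
Implicit Types (l g mu t : R) (xi : R -> R).

(* At z.2 = 0 the quotient is 0 / 0, which is 0 by the library's convention;
   this value is irrelevant, see [friction_plane]. *)
Definition pendulum_field l g mu xi t (z : R^o * R^o) : R^o * R^o :=
  let q := z.1 in let p := z.2 in
  (p,
   xi^`(2)%classic t / l * sin q
   - mu / l * `|xi^`(2)%classic t * cos q - l * p ^+ 2 + g * sin q| * (p / `|p|)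
   - g / l * cos q).

(* The slice, at any fixed time, of the plane p = 0 of (q, p, t)-space. *)
Definition friction_plane : set (R^o * R^o) := [set z | z.2 = 0].

(* Time is frozen: limits are taken in the state variables only. *)
Definition Phi l g mu xi (q p t : R) : set (R^o * R^o) :=
  filippov (pendulum_field l g mu xi t) friction_plane (q, p).

(* [q] and [p] are total functions of which only the values on the interval [I]
   matter: the (at most two) endpoints of [I], where the two-sided derivative
   could see values outside of [I], form a negligible set. [I] is an interval
   of any kind, and absolute continuity on [I] means absolute continuity on
   every compact subinterval, which for compact [I] is absolute continuity on
   [I] itself. *)
Definition is_solution l g mu xi (I : set R) (q p : R -> R) : Prop :=
  [/\ is_interval I,
      forall a b, I a -> I b ->
        absolutely_continuous a b q /\ absolutely_continuous a b p &
      {ae @lebesgue_measure R, forall t, I t ->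
        [/\ derivable q t 1, derivable p t 1 &
            Phi l g mu xi (q t) (p t) t (q^`() t, p^`() t)]}].

End Pendulum.

(* Main.v *)
Require Import Defs.
From mathcomp Require Import lra ring.

Set Implicit Arguments.
Unset Strict Implicit.
Unset Printing Implicit Defensive.

Local Open Scope ring_scope.
Local Open Scope classical_set_scope.

(* The friction term is, up to a nonnegative locally Lipschitz factor, minus the
   sign of p, a monotone multivalued map, so the inclusion satisfies a one-sided
   Lipschitz condition. For two solutions (q, p) and (r, s), every derivative
   allowed by Phi therefore gives D' <= K * D almost everywhere, where
   D = (q - r)^2 + (p - s)^2, with K depending only on bounds for p, s and the
   second derivative of xi. As D is absolutely continuous, Gronwall's
   inequality yields D = 0. No smallness of the time interval is required. *)

(** * Calculus of absolutely continuous functions on a segment *)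

Section AbsolutelyContinuous.
Context {R : realType}.
Implicit Types (a b e : R) (f g h : R -> R).

(* Cousin's lemma, phrased for an additive interval predicate instead of gauges
   and tagged partitions. *)
Lemma cousin (P : R -> R -> Prop) a b : a <= b ->
  (forall u v w, u <= v -> v <= w -> P u v -> P v w -> P u w) ->
  (forall t, a <= t <= b -> exists2 d, 0 < d & forall u v,
    a <= u -> u <= t -> t <= v -> v <= b -> t - d < u -> v < t + d -> P u v) ->
  P a b.
Proof.
move=> ab Ptrans Ploc; pose S := [set x | a <= x <= b /\ P a x].
have Sa : S a.
  split; first lra.
  by have [|d d0] := Ploc a; [lra|apply; lra].
have ubS : ubound S b by move=> x [/andP[]].
have supS : has_sup S by split; [exists a|exists b].
have as_ : a <= sup S by apply: ub_le_sup => //; exists b.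
have sb : sup S <= b by apply: ge_sup => //; exists a.
have [|d d0 Pd] := Ploc (sup S); first by rewrite as_.
have [x [/andP[ax xb] Pax] sx] := sup_adherent d0 supS.
have xs : x <= sup S by apply: ub_le_sup; [exists b|split; rewrite ?ax].
(* The point [x] of [S] lies within [d] of [sup S], so [P a x] glues with the local statement
   [P x v]. *)
have sup_ge v : sup S <= v -> v <= b -> v < sup S + d -> P a v.
  by move=> sv vb vd; apply: (Ptrans a x v) => //; [lra|apply: Pd].
have [bs|sb'] := leP b (sup S); first by apply: sup_ge => //; lra.
(* If [sup S < b], this [v] is a member of [S] beyond [sup S]. *)
have [v vE] : exists v, v = Num.min b (sup S + d / 2) by eexists.
have [vb vs sv] : [/\ v <= b, v <= sup S + d / 2 & sup S < v].
  by rewrite vE ge_min lexx ge_min lexx orbT lt_min sb'; split=> //; lra.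
have : v <= sup S.
  by apply: ub_le_sup; [exists b|split; [lra|apply: sup_ge; lra]].
lra.
Qed.

(** Serves Lipschitz functions, sums, differences and products alike. The factor [|K| + 1] is
    positive for [K] of any sign, so [e] can be divided by it. *)
Lemma absolutely_continuous_dominated a b f g h (K : R) :
  absolutely_continuous a b f -> absolutely_continuous a b g ->
  (forall u v, a <= u -> u <= v -> v <= b ->
    `|h v - h u| <= K * (`|f v - f u| + `|g v - g u|)) ->
  absolutely_continuous a b h.
Proof.
move=> fac gac hfg e e0.
have K0 : 0 < `|K| + 1 by rewrite ltr_wpDl.
have e'0 : 0 < e / (2 * (`|K| + 1)) by rewrite divr_gt0// mulr_gt0.
have [d1 d10 fd] := fac _ e'0; have [d2 d20 gd] := gac _ e'0.
exists (Num.min d1 d2); first by rewrite lt_min d10.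
move=> n u v uv triv; rewrite lt_min => /andP[s1 s2].
have := fd _ _ _ uv triv s1; have := gd _ _ _ uv triv s2.
rewrite !ltr_pdivlMr ?mulr_gt0// => gs fs.
apply: (@le_lt_trans _ _ ((`|K| + 1) *
    (\sum_(i < n) `|f (v i) - f (u i)| + \sum_(i < n) `|g (v i) - g (u i)|))).
  rewrite -big_split mulr_sumr; apply: ler_sum => i _.
  have [aui [uvi vib]] := uv i.
  apply: (le_trans (hfg _ _ aui uvi vib)).
  by apply: ler_wpM2r; [rewrite addr_ge0|rewrite (le_trans (ler_norm K))// lerDl].
lra.
Qed.

Lemma absolutely_continuous_lipschitz a b f (K : R) :
  (forall u v, a <= u -> u <= v -> v <= b -> `|f v - f u| <= K * (v - u)) ->
  absolutely_continuous a b f.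
Proof.
move=> fK; have idac : absolutely_continuous a b id.
  move=> e e0; exists e => // n u v uv _; apply: le_lt_trans.
  by apply: ler_sum => i _; have [_ [? _]] := uv i; rewrite ger0_norm// subr_ge0.
apply: (absolutely_continuous_dominated (K := `|K|) idac idac) => u v au uv vb.
apply: (le_trans (fK _ _ au uv vb)).
have vu : 0 <= v - u by rewrite subr_ge0.
rewrite /= (ger0_norm vu) -[leLHS]addr0 [leRHS]mulrDr.
by rewrite lerD ?mulr_ge0// ler_wpM2r// ler_norm.
Qed.

Lemma absolutely_continuousD a b f g :
  absolutely_continuous a b f -> absolutely_continuous a b g ->
  absolutely_continuous a b (f + g).
Proof.
move=> fac gac; apply: (absolutely_continuous_dominated (K := 1) fac gac).
move=> u v _ _ _; rewrite mul1r !fctE.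
by rewrite (_ : _ - _ = (f v - f u) + (g v - g u)) ?ler_normD//; ring.
Qed.

Lemma absolutely_continuousB a b f g :
  absolutely_continuous a b f -> absolutely_continuous a b g ->
  absolutely_continuous a b (f - g).
Proof.
move=> fac gac; apply: (absolutely_continuous_dominated (K := 1) fac gac).
move=> u v _ _ _; rewrite mul1r !fctE.
by rewrite (_ : _ - _ = (f v - f u) - (g v - g u)) ?ler_normB//; ring.
Qed.

(** Absolute continuity with [e = 1], applied to a single interval, bounds the oscillation on short
    segments; Cousin's lemma glues the bounds. *)
Lemma absolutely_continuous_bounded a b f : absolutely_continuous a b f ->
  exists M, forall t, a <= t <= b -> `|f t| <= M.
Proof.
have [ab|ba] := leP a b; last by exists 0 => t; lra.
move=> fac; apply: (@cousin (fun u v => exists M, forall t, u <= t <= v -> `|f t| <= M)) => //.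
  move=> u v w uv vw [M1 b1] [M2 b2]; exists (Num.max M1 M2) => t /andP[ut tw].
  rewrite le_max; have [tv|vt] := leP t v; first by rewrite b1 ?ut.
  by rewrite b2 ?orbT// tw ltW.
have [d d0 fd] := fac 1 ltr01.
have small u v : a <= u -> u <= v -> v <= b -> v - u < d -> `|f v - f u| < 1.
  move=> au uv vb vud; have := fd 1%N (fun=> u) (fun=> v).
  rewrite !big_ord1; apply => //.
  by move=> i j _ _ _; rewrite !ord1.
move=> t /andP[at_ tb]; exists d => // u v au ut tv vb tdu vtd.
exists (`|f t| + 1) => x /andP[ux xv].
have [tx|xt] := leP t x.
  have := ler_normD (f x - f t) (f t); rewrite subrK.
  by have := @small t x at_ tx; lra.
have := ler_normB (f t) (f t - f x); rewrite opprB addrCA subrr addr0.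
by have := @small x t; lra.
Qed.

Lemma absolutely_continuousM a b f g :
  absolutely_continuous a b f -> absolutely_continuous a b g ->
  absolutely_continuous a b (f * g).
Proof.
move=> fac gac.
have [M fM] := absolutely_continuous_bounded fac.
have [N gN] := absolutely_continuous_bounded gac.
apply: (absolutely_continuous_dominated (K := Num.max M N) fac gac) => u v au uv vb.
rewrite !fctE (_ : _ - _ = g v * (f v - f u) + f u * (g v - g u)); last by ring.
rewrite (le_trans (ler_normD _ _))// !normrM mulrDr.
by rewrite lerD// ler_wpM2r// le_max ?fM ?gN ?orbT//; lra.
Qed.

(** * Monotonicity from the sign of the derivative almost everywhere *)

Lemma sum_length_le_measure n (u v : 'I_n -> R) (U : set R) :
  measurable U -> (forall i, u i <= v i) ->
  trivIset setT (fun i => `]u i, v i[) -> (forall i, `]u i, v i[ `<=` U) ->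
  ((\sum_(i < n) (v i - u i))%:E <= lebesgue_measure U)%E.
Proof.
move=> mU uv triv sub.
apply: (@le_trans _ _ (lebesgue_measure (\big[setU/set0]_(i < n) `]u i, v i[))).
  rewrite measure_bigsetU_ord//= -sumEFin; apply: lee_sum => i _.
  rewrite lebesgue_measure_itv/= lte_fin; case: ltP => //.
  by move=> vu; rewrite lee_fin; lra.
apply: le_measure; rewrite ?inE//; first by apply: bigsetU_measurable.
by apply: (big_ind (fun A => A `<=` U)) => // A B AU BU; rewrite subUset.
Qed.

(** Straddle estimate: difference quotients at [t] are below [e] on both sides, and the increment
    over [[u, v]] is split at [t]. *)
Lemma derive_le0_near f (t df e : R) : is_derive t 1 f df -> df <= 0 -> 0 < e ->
  exists2 d, 0 < d & forall u v, u <= t -> t <= v -> t - d < u -> v < t + d ->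
    f v - f u <= e * (v - u).
Proof.
move=> [fd <-] df0 e0.
have : \forall h \near 0^', h^-1 *: (f (h *: 1 + t) - f t) < e.
  by apply: (cvgr_lt _ fd); apply: le_lt_trans e0.
case/nbhs_ballP => d /= d0 bd; exists d => // u v ut tv tu vt.
have key (h : R) : `|h| < d -> h != 0 -> h^-1 * (f (h + t) - f t) < e.
  move=> hd h0; have := bd h; rewrite /ball/= sub0r normrN => /(_ hd h0).
  by rewrite /GRing.scale/= mulr1.
have left_ : f t - f u <= e * (t - u).
  have [->|ut'] := eqVneq u t; first by rewrite !subrr mulr0.
  have ltut : u - t < 0 by rewrite subr_lt0 lt_neqAle ut'.
  have := key (u - t); rewrite subrK ltr0_norm// lt_eqF// => /(_ _ isT) H.
  have : (u - t)^-1 * (f u - f t) < e by apply: H; lra.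
  by rewrite mulrC ltr_ndivrMr//; lra.
have right_ : f v - f t <= e * (v - t).
  have [->|vt'] := eqVneq v t; first by rewrite !subrr mulr0.
  have lttv : 0 < v - t by rewrite subr_gt0 lt_neqAle eq_sym vt'.
  have := key (v - t); rewrite subrK gtr0_norm// gt_eqF// => /(_ _ isT) H.
  have : (v - t)^-1 * (f v - f t) < e by apply: H; lra.
  by rewrite mulrC ltr_pdivrMr//; lra.
lra.
Qed.

(* Outside the exceptional null set [N] the increment of [f] is at most [e]
   times the length; around [N] it is controlled by absolute continuity, as the
   intervals met there fit in an open set of small measure. Cousin's lemma glues
   these local estimates. *)
Lemma absolutely_continuous_nincr a b f : a <= b ->
  absolutely_continuous a b f ->
  {ae @lebesgue_measure R, forall t, a <= t <= b ->
    exists2 df, is_derive t 1 f df & df <= 0} ->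
  f b <= f a.
Proof.
move=> ab fac [N [mN N0 subN]]; apply/ler_addgt0Pr => e e0.
have ba1 : 0 < b - a + 1 by lra.
(* Slopes will contribute at most [e1 * (b - a)] and the intervals around [N] less than [e1], in
   total less than [e]. *)
have [e1 e1E] : exists e1, e1 = e / (b - a + 1) by eexists.
have e10 : 0 < e1 by rewrite e1E divr_gt0.
have [d d0 fd] := fac _ e10.
(* Outer regularity makes the difference of [U] and [N] small; as [N] is null, [U] itself has
   measure below [d]. *)
have [|U [oU NU mUN]] := lebesgue_regularity_outer mN _ d0.
  by rewrite [ltLHS]N0.
have mU : measurable U by exact: measurable_realfun.open_measurable.
have mUd : (lebesgue_measure U < d%:E)%E.
  rewrite -(setDUK NU); apply: le_lt_trans mUN.
  rewrite (le_trans (measureU2 _ _ _))//; first exact: measurableD.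
  by rewrite [X in (X + _)%E]N0 add0e.
(* The disjoint intervals are carried along, so that absolute continuity is applied once, to the
   whole family, after gluing. *)
pose P u v := exists n (x y : 'I_n -> R), [/\
  (forall i, u <= x i /\ x i <= y i /\ y i <= v),
  (forall i, `]x i, y i[ `<=` U),
  trivIset setT (fun i => `]x i, y i[) &
  f v - f u <= e1 * (v - u) + \sum_(i < n) `|f (y i) - f (x i)|].
have : P a b.
  apply: cousin => //.
    move=> u v w uv vw [n1 [x1 [y1 [xy1 U1 tr1 le1]]]].
    move=> [n2 [x2 [y2 [xy2 U2 tr2 le2]]]].
    exists (n1 + n2)%N.
    exists (fun i => match fintype.split i with inl j => x1 j | inr k => x2 k end).
    exists (fun i => match fintype.split i with inl j => y1 j | inr k => y2 k end).
    split.
    - by move=> i; case: fintype.split => j; [have := xy1 j|have := xy2 j]; lra.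
    - by move=> i; case: fintype.split => j.
    (* Intervals from different families lie on opposite sides of [v]. *)
    - move=> i j _ _ H; apply: (can_inj (@splitK _ _)); move: H.
      case: (fintype.split i) => i'; case: (fintype.split j) => j' /=.
      + by move=> /tr1 ->.
      + case=> z []; rewrite /= !in_itv/= => zi zj; exfalso.
        by have := xy1 i'; have := xy2 j'; lra.
      + case=> z []; rewrite /= !in_itv/= => zi zj; exfalso.
        by have := xy2 i'; have := xy1 j'; lra.
      + by move=> /tr2 ->.
    - rewrite big_split_ord/=.
      under eq_bigr do rewrite (unsplitK (inl _)).
      under [X in _ + (_ + X)]eq_bigr do rewrite (unsplitK (inr _)).
      lra.
  (* Near a point of [N] the family is the single interval []u, v[] inside [U]; elsewhere it is
     empty and the slope estimate suffices. *)
  move=> t tab; have [Nt|Nt] := pselect (N t).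
    have /nbhs_ballP[r /= r0 rU] : nbhs t U.
      by apply: open_nbhs_nbhs; split => //; exact: NU.
    exists r => // u v au ut tv vb tu vt.
    exists 1%N, (fun=> u), (fun=> v); split.
    - by move=> _; lra.
    - move=> _ x; rewrite /= in_itv/= => /andP[ux xv]; apply: rU.
      by rewrite /ball/= ltr_distlC; lra.
    - by move=> i j _ _ _; rewrite !ord1.
    - rewrite big_ord1 (le_trans (ler_norm _))// lerDr mulr_ge0// ?(ltW e10)//.
      lra.
  have [df fdf df0] : exists2 df, is_derive t 1 f df & df <= 0.
    by apply: contrapT => H; apply: Nt; apply: subN => /(_ tab).
  have [r r0 fr] := derive_le0_near fdf df0 e10.
  exists r => // u v au ut tv vb tu vt.
  exists 0%N, (fun=> 0), (fun=> 0); split; try by case.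
  by rewrite big_ord0 addr0; exact: fr.
move=> [n [x [y [xy xyU triv fab]]]].
have sxy : \sum_(i < n) (y i - x i) < d.
  rewrite -lte_fin; apply: le_lt_trans mUd.
  by apply: sum_length_le_measure => // i; have := xy i; lra.
have := fd _ _ _ xy triv sxy.
have : e1 * (b - a + 1) = e by rewrite e1E divfK// gt_eqF.
lra.
Qed.

End AbsolutelyContinuous.

(** * Linear inequalities inherited by the Filippov set *)

Section FilippovHalfplane.
Context {R : realType} {U : normedModType R}.

(** By minimality of the Filippov set among closed convex sets, it suffices that the half-plane at
    [z] contains the limit values, which follows from continuity of the coefficients. *)
Lemma filippov_halfplane (f : U -> R^o * R^o) (M : set U) (A B C : U -> R) :
  continuous A -> continuous B -> continuous C ->
  (forall u, ~ M u -> A u * (f u).1 + B u * (f u).2 <= C u) ->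
  forall z w, filippov f M z w -> A z * w.1 + B z * w.2 <= C z.
Proof.
move=> cA cB cC fABC z; pose H := [set w : R^o * R^o | A z * w.1 + B z * w.2 <= C z].
suff HS : filippov f M z `<=` H by move=> w /HS.
apply: smallest_sub; first split.
- have -> : H = (fun w : R^o * R^o => A z * w.1 + B z * w.2) @^-1` [set x | x <= C z] by [].
  apply: closed_comp; last exact: closed_le.
  move=> w _; apply: cvgD; apply: cvgM; try exact: cvg_cst.
  + exact: cvg_fst.
  + exact: cvg_snd.
- move=> x y k; rewrite !inE /H/= => Hx Hy.
  change (A z * (k%:num * x.1 + (1 - k%:num) * y.1) +
          B z * (k%:num * x.2 + (1 - k%:num) * y.2) <= C z).
  have k0 : 0 <= k%:num by [].
  have k1 : 0 <= 1 - k%:num by rewrite subr_ge0.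
  have := ler_wpM2l k0 Hx; have := ler_wpM2l k1 Hy; lra.
- move=> w cw; rewrite /H/=; apply/ler_addgt0Pr => e e0.
  (* [phi] is jointly continuous in value and base point. A cluster point [w] has values [f u] near
     it with [u] near [z] off [M], where [phi (f u, u) <= 0]; hence [phi (w, z) < e]. *)
  pose phi (v : (R^o * R^o) * U) := A v.2 * v.1.1 + B v.2 * v.1.2 - C v.2.
  have : phi v @[v --> (w, z)] --> phi (w, z).
    have c1 : v.1.1 @[v --> (w, z)] --> w.1.
      by apply: (cvg_comp _ _ (@cvg_fst _ _ _ _ _)); exact: cvg_fst.
    have c2 : v.1.2 @[v --> (w, z)] --> w.2.
      by apply: (cvg_comp _ _ (@cvg_fst _ _ _ _ _)); exact: cvg_snd.
    have cz (F : U -> R) : continuous F -> F v.2 @[v --> (w, z)] --> F z.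
      by move=> cF; apply: (cvg_comp _ _ (@cvg_snd _ _ _ _ _)); exact: cF.
    by apply: cvgB; [apply: cvgD; apply: cvgM => //; exact: cz|exact: cz].
  move/cvgrPdist_lt => /(_ e e0) [[P Q] /= [Pw Qz] PQ].
  have : (f @ within (~` M) (nbhs z)) (f @` (Q `&` ~` M)).
    by apply: filterS Qz => u Qu Mu; exists u.
  move/cw => /(_ _ Pw) [v [[u [Qu Mu] fuv] Pv]].
  have := PQ (v, u) (conj Pv Qu); rewrite /phi/= -fuv.
  by have := fABC u Mu; rewrite ltr_distlC; lra.
Qed.

End FilippovHalfplane.

(** * Lipschitz bounds for sine and cosine *)

Section MeanValue.
Context {R : realType}.

Lemma derive_bounded_le (f df : R -> R) (u v K : R) : u <= v ->
  (forall x, u <= x <= v -> is_derive x 1 f (df x)) ->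
  (forall x, u <= x <= v -> `|df x| <= K) ->
  `|f v - f u| <= K * (v - u).
Proof.
move=> uv fdf dfK.
have [||x + ->] := MVT_segment (f := f) (df := df) uv.
- by move=> x /subset_itv_oo_cc; rewrite in_itv; exact: fdf.
- apply: continuous_in_subspaceT => x; rewrite inE/= in_itv => /fdf [dfx _].
  exact/differentiable_continuous/derivable1_diffP.
- rewrite in_itv => xuv.
  by rewrite normrM (@ger0_norm _ (v - u)) ?subr_ge0// ler_wpM2r ?subr_ge0// dfK.
Qed.

Lemma sin_dist_le (x y : R) : `|sin x - sin y| <= `|x - y|.
Proof.
wlog yx : x y / y <= x.
  by move=> H; have [/H//|/ltW/H] := leP y x; rewrite distrC (distrC x).
rewrite [leRHS]ger0_norm ?subr_ge0// -[leRHS]mul1r.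
by apply: (derive_bounded_le (df := cos)) => // z _; exact: cos_max.
Qed.

Lemma cos_dist_le (x y : R) : `|cos x - cos y| <= `|x - y|.
Proof.
wlog yx : x y / y <= x.
  by move=> H; have [/H//|/ltW/H] := leP y x; rewrite distrC (distrC x).
rewrite [leRHS]ger0_norm ?subr_ge0// -[leRHS]mul1r.
apply: (derive_bounded_le (df := fun z => - sin z)) => // z _.
by rewrite normrN; exact: sin_max.
Qed.

End MeanValue.

(** * One-sided Lipschitz estimate for the pendulum inclusion *)

Section Pendulum.
Context {R : realType}.
Implicit Types (l g mu c q p : R).

(* [c] stands for the second derivative of [xi] at the current time; the
   paper's [a] and [b] are [drift l g c q] and [friction l g mu c q 0]. *)
Definition drift l g c q : R := c / l * sin q - g / l * cos q.

Definition friction l g mu c q p : R :=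
  mu / l * `|c * cos q - l * p ^+ 2 + g * sin q|.

Lemma friction_ge0 l g mu c q p : 0 < l -> 0 < mu -> 0 <= friction l g mu c q p.
Proof. by move=> l0 mu0; rewrite mulr_ge0// divr_ge0// ltW. Qed.

(** Each claim amounts to linear inequalities in [w] with coefficients continuous in the state, so
    it passes from the field to [Phi]. For [p <> 0] the last two pin [w.2] to the value of the
    field; for [p = 0] the second gives the friction interval around the drift and the third is
    trivial. *)
Lemma Phi_sub l g mu xi q p t (w : R^o * R^o) : 0 < l -> 0 < mu ->
  Phi l g mu xi q p t w ->
  let c := xi^`(2) t in
  [/\ w.1 = p,
      `|w.2 - drift l g c q| <= friction l g mu c q p &
      p * (w.2 - drift l g c q) <= - (friction l g mu c q p * `|p|)].
Proof.
move=> l0 mu0 Phiw c.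
pose a (z : R^o * R^o) : R := drift l g c z.1.
pose b (z : R^o * R^o) : R := friction l g mu c z.1 z.2.
have c2 : continuous (fun z : R^o * R^o => z.2 : R) by move=> z; exact: cvg_snd.
have csin : continuous (fun z : R^o * R^o => sin z.1 : R).
  move=> z; apply: (cvg_comp _ _ (@cvg_fst _ _ _ _ _)); exact: continuous_sin.
have ccos : continuous (fun z : R^o * R^o => cos z.1 : R).
  move=> z; apply: (cvg_comp _ _ (@cvg_fst _ _ _ _ _)); exact: continuous_cos.
have ca : continuous a.
  by move=> z; apply: cvgB; apply: cvgM; try exact: cvg_cst; [exact: csin|exact: ccos].
have cb : continuous b.
  move=> z; apply: cvgM; first exact: cvg_cst.
  apply: cvg_norm; apply: cvgD; last by apply: cvgM; [exact: cvg_cst|exact: csin].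
  apply: cvgB; first by apply: cvgM; [exact: cvg_cst|exact: ccos].
  by apply: cvgM; [exact: cvg_cst|apply: cvgM; exact: c2].
have cst0 (k : R) : continuous (fun _ : R^o * R^o => k) by move=> z; exact: cvg_cst.
have field_E (z : R^o * R^o) : (pendulum_field l g mu xi t z).2 =
    a z - b z * (z.2 / `|z.2|).
  exact: addrAC.
have sg_le1 (z : R) : `|z / `|z| | <= 1.
  have [->|z0] := eqVneq z 0; first by rewrite mul0r normr0.
  by rewrite normrM normfV normr_id divff// normr_eq0.
have bsg_le z : `|b z * (z.2 / `|z.2|)| <= b z.
  rewrite normrM ger0_norm ?friction_ge0// -[leRHS]mulr1.
  by rewrite ler_wpM2l ?friction_ge0.
split.
- apply/eqP; rewrite eq_le; apply/andP; split.
  + have := filippov_halfplane (cst0 1) (cst0 0) c2 _ Phiw.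
    by rewrite mul1r mul0r addr0; apply => u _; rewrite mul1r mul0r addr0.
  + have := filippov_halfplane (cst0 (- 1)) (cst0 0) (fun z => cvgN (c2 z)) _ Phiw.
    by rewrite mulN1r mul0r addr0 lerN2; apply => u _; rewrite mulN1r mul0r addr0.
- have H1 : 0 * w.1 + - 1 * w.2 <= b (q, p) - a (q, p).
    apply: (filippov_halfplane (cst0 0) (cst0 (- 1))
      (fun z => cvgB (cb z) (ca z)) _ Phiw) => u _.
    rewrite field_E mul0r add0r mulN1r opprB lerD2r.
    exact: le_trans (ler_norm _) (bsg_le u).
  have H2 : 0 * w.1 + 1 * w.2 <= b (q, p) + a (q, p).
    apply: (filippov_halfplane (cst0 0) (cst0 1)
      (fun z => cvgD (cb z) (ca z)) _ Phiw) => u _.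
    rewrite field_E mul0r add0r mul1r addrC lerD2r lerNl.
    by have := bsg_le u; rewrite ler_norml => /andP[].
  by rewrite ler_norml; move: H1 H2; rewrite /a /b /=; lra.
(* The normal [(0, p)] varies with the state. Off the plane the inequality is an equality, since
   [p * (p / |p|) = |p|]. *)
- have H : 0 * w.1 + p * w.2 <= p * a (q, p) - b (q, p) * `|p|.
    apply: (filippov_halfplane (cst0 0) c2
      (fun z => cvgB (cvgM (c2 z) (ca z)) (cvgM (cb z) (cvg_norm (c2 z)))) _ Phiw).
    move=> u u20; rewrite field_E mul0r add0r mulrBr lerD2l lerN2 mulrCA.
    rewrite ler_wpM2l ?friction_ge0// mulrA -expr2 -real_normK ?num_real//.
    by rewrite expr2 mulfK// normr_eq0; exact/eqP.
  by move: H; rewrite /a /b /=; lra.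
Qed.

Lemma drift_dist_le l g c q r A : 0 < l -> 0 < g -> `|c| <= A ->
  `|drift l g c q - drift l g c r| <= (A + g) / l * `|q - r|.
Proof.
move=> l0 g0 cA.
rewrite /drift (_ : _ - _ =
  (c * (sin q - sin r) - g * (cos q - cos r)) / l); last by ring.
rewrite normrM normfV (gtr0_norm l0) mulrAC ler_wpM2r ?invr_ge0 ?(ltW l0)//.
rewrite (le_trans (ler_normB _ _))// !normrM mulrDl lerD//.
  by rewrite ler_pM// sin_dist_le.
by rewrite (gtr0_norm g0) ler_wpM2l ?(ltW g0)// cos_dist_le.
Qed.

(** The reverse triangle inequality removes the modulus; [2 * l * M] comes from factoring
    [p ^+ 2 - s ^+ 2] as [(p + s) * (p - s)]. *)
Lemma friction_dist_le l g mu c q p r s A M : 0 < l -> 0 < g -> 0 < mu ->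
  `|c| <= A -> `|p| <= M -> `|s| <= M ->
  `|friction l g mu c q p - friction l g mu c r s| <=
    mu / l * (A + g + 2 * l * M) * (`|q - r| + `|p - s|).
Proof.
move=> l0 g0 mu0 cA pM sM.
rewrite /friction -mulrBr normrM -[leRHS]mulrA ger0_norm ?divr_ge0 ?(ltW mu0) ?(ltW l0)//.
rewrite ler_wpM2l ?divr_ge0 ?(ltW mu0) ?(ltW l0)//.
rewrite (le_trans (ler_dist_dist _ _))//.
rewrite (_ : _ - _ = (c * (cos q - cos r) + g * (sin q - sin r))
   - l * (p + s) * (p - s)); last by ring.
have A0 : 0 <= A := le_trans (normr_ge0 _) cA.
have M0 : 0 <= M := le_trans (normr_ge0 _) pM.
have h1 : `|c * (cos q - cos r)| <= A * `|q - r|.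
  by rewrite normrM ler_pM// cos_dist_le.
have h2 : `|g * (sin q - sin r)| <= g * `|q - r|.
  by rewrite normrM (gtr0_norm g0) ler_wpM2l ?(ltW g0)// sin_dist_le.
have h3 : `|l * (p + s) * (p - s)| <= 2 * l * M * `|p - s|.
  rewrite !normrM (gtr0_norm l0) ler_wpM2r//.
  have := ler_normD p s; nra.
have h4 := ler_normD (c * (cos q - cos r)) (g * (sin q - sin r)).
rewrite (le_trans (ler_normB _ _))//.
have h5 : 0 <= (A + g) * `|p - s| by rewrite mulr_ge0// addr_ge0// ltW.
have h6 : 0 <= 2 * l * M * `|q - r| by rewrite !mulr_ge0// ltW.
lra.
Qed.

(* Dissipativity of dry friction: the friction forces [w1] and [w2] satisfy
   [(p - s) * (w1 - w2) <= (b2 - b1) * (`|p| - `|s|)], so only the variation of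
   the friction coefficient contributes, not the jump of its sign. *)
Lemma friction_dissipative (p s w1 w2 b1 b2 : R) :
  `|w1| <= b1 -> p * w1 <= - (b1 * `|p|) ->
  `|w2| <= b2 -> s * w2 <= - (b2 * `|s|) ->
  (p - s) * (w1 - w2) <= `|b1 - b2| * `|p - s|.
Proof.
move=> wb1 pw1 wb2 sw2.
have sw1 : - (b1 * `|s|) <= s * w1.
  by have := ler_norm (- (s * w1)); rewrite normrN normrM; have := normr_ge0 s; nra.
have pw2 : - (b2 * `|p|) <= p * w2.
  by have := ler_norm (- (p * w2)); rewrite normrN normrM; have := normr_ge0 p; nra.
apply: (@le_trans _ _ ((b2 - b1) * (`|p| - `|s|))); first lra.
rewrite (le_trans (ler_norm _))// normrM distrC ler_wpM2l//.
exact: ler_dist_dist.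
Qed.

(** The left side is the derivative of the squared distance when the states move with velocities
    [(p, y1)] and [(s, y2)]. With [x = |q - r|] and [y = |p - s|], it is at most
    [2xy + 2 La xy + 2 Lb (x + y) y], and [2xy <= x^2 + y^2] yields the constants 1, [La] and
    [3 * Lb]. *)
Lemma one_sided_lipschitz (q p r s a1 a2 b1 b2 y1 y2 La Lb : R) :
  0 <= La -> 0 <= Lb ->
  `|a1 - a2| <= La * `|q - r| -> `|b1 - b2| <= Lb * (`|q - r| + `|p - s|) ->
  `|y1 - a1| <= b1 -> p * (y1 - a1) <= - (b1 * `|p|) ->
  `|y2 - a2| <= b2 -> s * (y2 - a2) <= - (b2 * `|s|) ->
  2 * ((q - r) * (p - s) + (p - s) * (y1 - y2)) <=
    (1 + La + 3 * Lb) * ((q - r) ^+ 2 + (p - s) ^+ 2).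
Proof.
move=> La0 Lb0 aLa bLb h1 h2 h3 h4.
have diss := friction_dissipative h1 h2 h3 h4.
rewrite -[(q - r) ^+ 2]real_normK ?num_real// -[(p - s) ^+ 2]real_normK ?num_real//.
have h5 := ler_norm ((q - r) * (p - s)).
have h6 := ler_norm ((p - s) * (a1 - a2)).
rewrite normrM in h5; rewrite normrM in h6.
have x0 := normr_ge0 (q - r); have y0 := normr_ge0 (p - s).
have h7 : 0 <= La * (`|q - r| - `|p - s|) ^+ 2 by rewrite mulr_ge0// sqr_ge0.
have h8 : 0 <= Lb * (`|q - r| - `|p - s|) ^+ 2 by rewrite mulr_ge0// sqr_ge0.
have h9 := ler_wpM2r y0 aLa; have h10 := ler_wpM2r y0 bLb.
have h11 := sqr_ge0 (`|q - r| - `|p - s|).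
have h12 : 0 <= La * `|p - s| ^+ 2 by rewrite mulr_ge0// sqr_ge0.
have h13 : 0 <= La * `|q - r| ^+ 2 by rewrite mulr_ge0// sqr_ge0.
have h14 : 0 <= Lb * `|q - r| ^+ 2 by rewrite mulr_ge0// sqr_ge0.
lra.
Qed.
End Pendulum.

(** * Gronwall's inequality and right-uniqueness *)

Lemma gronwall {R : realType} (a b K : R) (D : R -> R) : a <= b -> 0 <= K ->
  absolutely_continuous a b D ->
  {ae @lebesgue_measure R, forall t, a <= t <= b ->
    exists2 dD, is_derive t 1 D dD & dD <= K * D t} ->
  D b <= expR (K * (b - a)) * D a.
Proof.
move=> ab K0 Dac DK.
(* Integrating factor with [E a = 1]: almost everywhere [E * D] has derivative
   [E * (dD - K * D) <= 0], so it does not increase. *)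
pose E := expR \o (- K \*: (id - cst a)) : R -> R.
have dE (t : R) : is_derive t 1 E (expR (- K * (t - a)) * - K).
  apply: is_derive1_comp.
  apply: is_derive_eq.
  by rewrite subr0 /GRing.scale/= mulr1.
have Eac : absolutely_continuous a b E.
  apply: (absolutely_continuous_lipschitz (K := K)) => u v au uv vb.
  apply: (derive_bounded_le uv (fun x _ => dE x)) => x /andP[ux _].
  rewrite normrM normrN (ger0_norm K0) ger0_norm ?expR_ge0//.
  by rewrite -[leRHS]mul1r ler_wpM2r// -expR0 ler_expR; nra.
have : (E * D) b <= (E * D) a.
  apply: (absolutely_continuous_nincr ab); first exact: absolutely_continuousM.
  have aeF := ae_filter_ringOfSetsType (@lebesgue_measure R).
  apply: (filterS _ DK) => t /[apply] -[dD DdD dDK].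
  exists (E t *: dD + D t *: (expR (- K * (t - a)) * - K)).
    by apply: is_deriveM; exact: dE.
  rewrite (_ : _ + _ = expR (- K * (t - a)) * (dD - K * D t)).
    by rewrite mulr_ge0_le0 ?expR_ge0// subr_le0.
  by rewrite /E /GRing.scale /= !fctE /GRing.scale/=; ring.
change (expR (- K * (b - a)) * D b <= expR (- K * (a - a)) * D a ->
  D b <= expR (K * (b - a)) * D a).
rewrite subrr mulr0 expR0 mul1r.
by rewrite mulNr expRN mulrC ler_pdivrMr ?expR_gt0// mulrC.
Qed.

Theorem corollary1 (R : realType) (l g mu : R) (xi : R -> R)
  (l_gt0 : 0 < l) (g_gt0 : 0 < g) (mu_gt0 : 0 < mu)
  (xi_derivable : forall t : R, derivable xi t 1)
  (dxi_derivable : forall t : R, derivable xi^`() t 1)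
  (ddxi_lipschitz : lipschitz xi^`(2)) :
  forall q0 p0 t0 : R, exists2 t1 : R, t0 < t1 &
    forall (I J : set R) (q p r s : R -> R),
      is_solution l g mu xi I q p ->
      is_solution l g mu xi J r s ->
      I t0 -> q t0 = q0 -> p t0 = p0 ->
      J t0 -> r t0 = q0 -> s t0 = p0 ->
      forall t : R, t0 <= t <= t1 -> I t -> J t -> q t = r t /\ p t = s t.
Proof.
(* The length 1 is arbitrary: the estimates are made on [[t0, t]], with constants that may depend on
   [t] and on both solutions. *)
move=> q0 p0 t0; exists (t0 + 1); first by rewrite ltrDl.
move=> I J q p r s [itvI acI solI] [itvJ acJ solJ] It0 qt0 pt0 Jt0 rt0 st0.
move=> t /andP[t0t _] It Jt.
have [qac pac] := acI _ _ It0 It; have [rac sac] := acJ _ _ Jt0 Jt.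
have [A xiA] : exists A, forall x, t0 <= x <= t -> `|xi^`(2)%classic x| <= A.
  apply: (@absolutely_continuous_bounded _ t0 t).
  have [k xik] : exists k, forall x y, `|xi^`(2)%classic x - xi^`(2)%classic y| <= k * `|x - y|.
    (* [lipschitz] gives the bound for all constants beyond some [k], hence [k + 1]. *)
    have [k [_ kP]] := ddxi_lipschitz; exists (k + 1) => x y.
    by have := kP (k + 1); rewrite ltrDl ltr01 => /(_ isT (x, y)); apply.
  apply: (absolutely_continuous_lipschitz (K := k)) => u v _ uv _.
  by rewrite -[v - u]ger0_norm ?subr_ge0.
have [M1 pM] := absolutely_continuous_bounded pac.
have [M2 sM] := absolutely_continuous_bounded sac.
have [M ME] : exists M : R, M = Num.max M1 M2 by eexists.
have t0tt : t0 <= t0 <= t by rewrite lexx.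
have A0 : 0 <= A := le_trans (normr_ge0 _) (xiA _ t0tt).
have M0 : 0 <= M.
  by rewrite ME le_max (le_trans (normr_ge0 _) (pM _ t0tt)).
have [La LaE] : exists La : R, La = (A + g) / l by eexists.
have [Lb LbE] : exists Lb : R, Lb = mu / l * (A + g + 2 * l * M) by eexists.
have La0 : 0 <= La by rewrite LaE divr_ge0 ?addr_ge0// ltW.
have Lb0 : 0 <= Lb.
  rewrite LbE mulr_ge0 ?divr_ge0 ?(ltW mu_gt0) ?(ltW l_gt0)//.
  by rewrite !addr_ge0 ?mulr_ge0 ?(ltW g_gt0) ?(ltW l_gt0).
have [K KE] : exists K : R, K = 1 + La + 3 * Lb by eexists.
have K0 : 0 <= K by lra.
pose D := (q - r) * (q - r) + (p - s) * (p - s).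
have Dac : absolutely_continuous t0 t D.
  by apply: absolutely_continuousD; apply: absolutely_continuousM;
    exact: absolutely_continuousB.
have DE x : D x = (q x - r x) ^+ 2 + (p x - s x) ^+ 2.
  by rewrite /D !fctE !expr2.
(* The initial data agree, so [D t0 = 0] and Gronwall's bound becomes [D t <= 0]. *)
have := gronwall t0t K0 Dac; rewrite !DE qt0 rt0 pt0 st0 !subrr !expr0n addr0 mulr0.
case/(_ _)/wrap => [|Dt].
  have aeF := ae_filter_ringOfSetsType (@lebesgue_measure R).
  apply: (filterS2 _ _ solI solJ) => x {}solI {}solJ xt0t.
  have Ix : I x by exact: itvI xt0t.
  have Jx : J x by exact: itvJ xt0t.
  have [dq dp PhiI] := solI Ix; have [dr ds PhiJ] := solJ Jx.
  have [/= q'E h1 h2] := Phi_sub l_gt0 mu_gt0 PhiI.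
  have [/= r'E h3 h4] := Phi_sub l_gt0 mu_gt0 PhiJ.
  have isd (f : R -> R) : derivable f x 1 -> is_derive x 1 f (f^`() x).
    by move=> df; rewrite derive1E; exact: DeriveDef.
  have isdq := isd _ dq; have isdp := isd _ dp.
  have isdr := isd _ dr; have isds := isd _ ds.
  (* The product rule supplies the derivative of [D]; with [q' = p] and [r' = s] it equals the left
     side of [one_sided_lipschitz]. *)
  eexists; first exact: is_deriveD.
  rewrite q'E r'E /GRing.scale/= !fctE KE DE.
  have pM' : `|p x| <= M by rewrite ME le_max pM.
  have sM' : `|s x| <= M by rewrite ME le_max sM ?orbT.
  have da := drift_dist_le (q x) (r x) l_gt0 g_gt0 (xiA _ xt0t).
  have db := friction_dist_le (q x) (r x) l_gt0 g_gt0 mu_gt0 (xiA _ xt0t) pM' sM'.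
  rewrite -LaE in da; rewrite -LbE in db.
  have := one_sided_lipschitz La0 Lb0 da db h1 h2 h3 h4.
  lra.
have D0 : (q t - r t) ^+ 2 + (p t - s t) ^+ 2 == 0.
  by rewrite eq_le Dt addr_ge0 ?sqr_ge0.
move: D0; rewrite paddr_eq0 ?sqr_ge0// !sqrf_eq0 !subr_eq0.
by move=> /andP[/eqP-> /eqP->].
Qed.
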